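(* Riemann ZMC examples in $\mathbb{L}^3$ foliated by spacelike circles (of non-constant radius) contained in parallel timelike planes corresponding to the choice $\vec a=(1,1)$ have the explicit parametrizations $$X(r,v)=(x(r),m(r),m(r))+r(0,\sinh v,\cosh v),\qquad v\in\mathbb{R},\ r>0,\ \lambda r^2+1>0,$$ where $x(r)$ and $m(r)$ are as follows. (1) Case $\lambda=0$: $x(r)=r$ and $m(r)=r^3/3$. The surface is timelike and converges to a point as $r\to0$. (2) Case $\lambda>0$: $$x(r)=\frac{1}{\sqrt\lambda}\operatorname{arsinh}(\sqrt\lambda\, r),\qquad m(r)=\frac{1}{2\lambda^{3/2}}\left(\sqrt\lambda\, r\sqrt{\lambda r^2+1}-\operatorname{arsinh}(\sqrt\lambda\, r)\right).$$ The surface converges to a point as $r\to0$. (3) Case $\lambda<0$: $$x(r)=\frac{1}{\sqrt{-\lambda}}\arcsin(\sqrt{-\lambda}\,r),\qquad m(r)=\frac{1}{2\lambda}r\sqrt{\lambda r^2+1}+\frac{1}{4(-\lambda)^{3/2}}\arcsin(-2\lambda r^2-1).$$ Depending on the values of $v$, the surface contains spacelike, lightlike and timelike regions. The surface is included in the slab $0<x_1<\pi/(2\sqrt{-\lambda})$ and converges to a point as $r\to0$.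
   Context: $\mathbb{L}^3$ is $\mathbb{R}^3$ with the metric $\langle,\rangle=dx_1^2+dx_2^2-dx_3^2$. A surface is spacelike, timelike or lightlike at a point if the induced metric there is Riemannian, Lorentzian or degenerate. The mean curvature $H$ is defined on the non-degenerate part; ZMC means $H=0$ there. A spacelike circle in a plane $x_1=\text{const}$ is a hyperbola $s\mapsto p+r(0,\sinh s,\cosh s)$, $r>0$. A Riemann ZMC example is a non-rotational surface with zero mean curvature foliated by (pieces of) circles contained in parallel planes. The surfaces ''corresponding to $\vec a=(1,1)$'' are those of the form $X(q,v)=(x(q),m(q)\vec a)+\sqrt q(0,\sinh v,\cosh v)$ with $q=r^2$, $\vec a=(1,1)$ in the $x_2x_3$-plane, $x(q)=\frac12\int^q\frac{du}{\sqrt{\lambda u^2+u}}$, $m(q)=\frac12\int^q\frac{u\,du}{\sqrt{\lambda u^2+u}}$ (integrals up to additive constants), $\lambda\in\mathbb{R}$. ''Converges to a point as $r\to0$'' means $X(r,v)$ tends, for each fixed $v$, to one and the same point. *)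

(* Defs.v *)
From Stdlib Require Import Reals Lra.
From Coquelicot Require Import Coquelicot.
Open Scope R_scope.

(** Lorentz-Minkowski 3-space: the Coquelicot normed module R * R * R, with the
    metric dx1^2 + dx2^2 - dx3^2.  Its topology and affine structure are those
    of the product. *)
Notation L3 := (R * R * R)%type.

Definition x1 (p : L3) : R := fst (fst p).
Definition x2 (p : L3) : R := snd (fst p).
Definition x3 (p : L3) : R := snd p.

Definition lprod (p q : L3) : R := x1 p * x1 q + x2 p * x2 q - x3 p * x3 q.

(** Lorentzian cross product: lprod (lcross p q) w = det (p, q, w). *)
Definition lcross (p q : L3) : L3 :=
  (x2 p * x3 q - x3 p * x2 q,
   x3 p * x1 q - x1 p * x3 q,
   - (x1 p * x2 q - x2 p * x1 q)).

(** A parametrized surface is a total function X : R -> R -> L3 together with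
    a domain D; only its values on D matter. *)

Definition Du (X : R -> R -> L3) (u v : R) : L3 :=
  (Derive (fun t => x1 (X t v)) u,
   Derive (fun t => x2 (X t v)) u,
   Derive (fun t => x3 (X t v)) u).

Definition Dv (X : R -> R -> L3) (u v : R) : L3 :=
  (Derive (fun t => x1 (X u t)) v,
   Derive (fun t => x2 (X u t)) v,
   Derive (fun t => x3 (X u t)) v).

Definition tangent (X : R -> R -> L3) (u v : R) (w : L3) : Prop :=
  exists a b : R, w = plus (scal a (Du X u v)) (scal b (Dv X u v)).

Definition regular_surface (D : R -> R -> Prop) (X : R -> R -> L3) : Prop :=
  open (fun p : R * R => D (fst p) (snd p)) /\
  forall u v, D u v ->
    ex_diff_n (fun s t => x1 (X s t)) 2 u v /\
    ex_diff_n (fun s t => x2 (X s t)) 2 u v /\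
    ex_diff_n (fun s t => x3 (X s t)) 2 u v /\
    forall a b : R,
      plus (scal a (Du X u v)) (scal b (Dv X u v)) = zero -> a = 0 /\ b = 0.

Definition spacelike_at (X : R -> R -> L3) (u v : R) : Prop :=
  forall w, tangent X u v w -> w <> zero -> 0 < lprod w w.

Definition timelike_at (X : R -> R -> L3) (u v : R) : Prop :=
  exists w1 w2, tangent X u v w1 /\ tangent X u v w2 /\
    0 < lprod w1 w1 /\ lprod w2 w2 < 0 /\ lprod w1 w2 = 0.

Definition lightlike_at (X : R -> R -> L3) (u v : R) : Prop :=
  exists w, tangent X u v w /\ w <> zero /\
    forall w', tangent X u v w' -> lprod w w' = 0.

Definition unit_normal (X : R -> R -> L3) (u v : R) : L3 :=
  let n := lcross (Du X u v) (Dv X u v) in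
  scal (/ sqrt (Rabs (lprod n n))) n.

(** Half the trace of the second fundamental form with respect to the first,
    with the usual sign <N,N>; meaningful only where the induced metric is
    non-degenerate. *)
Definition mean_curvature (X : R -> R -> L3) (u v : R) : R :=
  let N := unit_normal X u v in
  let E := lprod (Du X u v) (Du X u v) in
  let F := lprod (Du X u v) (Dv X u v) in
  let G := lprod (Dv X u v) (Dv X u v) in
  let e := lprod (Du (Du X) u v) N in
  let f := lprod (Dv (Du X) u v) N in
  let g := lprod (Dv (Dv X) u v) N in
  lprod N N * (e * G - 2 * f * F + g * E) / (2 * (E * G - F ^ 2)).

Definition zmc (D : R -> R -> Prop) (X : R -> R -> L3) : Prop :=
  forall u v, D u v -> ~ lightlike_at X u v -> mean_curvature X u v = 0.

(** The vector field p |-> b x (p - p0) generates the one-parameter group of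
    rotations of L^3 with axis the line p0 + R b, so its integral curves are the
    orbits of that group.  A surface is rotational when, for some axis, the
    orbit of each of its points stays in the surface for short time; this
    includes open pieces of complete rotational surfaces. *)
Definition rotational (D : R -> R -> Prop) (X : R -> R -> L3) : Prop :=
  exists p0 b : L3, b <> zero /\
    forall u v, D u v ->
      exists (gam : R -> L3) (eps : R), 0 < eps /\ gam 0 = X u v /\
        forall t, Rabs t < eps ->
          is_derive gam t (lcross b (minus (gam t) p0)) /\
          exists u' v', D u' v' /\ gam t = X u' v'.

(** The point with parameter s of the spacelike circle of centre p and radius
    rho in the plane x1 = x1 p. *)
Definition spacelike_circle (p : L3) (rho s : R) : L3 :=
  plus p (scal rho ((0, sinh s, cosh s) : L3)).

(** Each curve X u _ lies in a spacelike circle of a plane x1 = const,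
    different u giving different planes, and the radius is not constant. *)
Definition foliated_by_spacelike_circles
    (D : R -> R -> Prop) (X : R -> R -> L3) : Prop :=
  exists (c : R -> L3) (rho : R -> R),
    (forall u v, D u v ->
       0 < rho u /\ exists s, X u v = spacelike_circle (c u) (rho u) s) /\
    (forall u v u' v', D u v -> D u' v' -> u <> u' -> x1 (c u) <> x1 (c u')) /\
    (exists u v u' v', D u v /\ D u' v' /\ rho u <> rho u').

Definition riemann_zmc_example (D : R -> R -> Prop) (X : R -> R -> L3) : Prop :=
  regular_surface D X /\ zmc D X /\ ~ rotational D X /\
  foliated_by_spacelike_circles D X.

(** The surfaces X(q,v) of the choice a = (1,1).  The integrals up to additive
    constants are integrals from an arbitrary base point q0 plus constants. *)
Definition corresponds_to_11 (lam : R) (Y : R -> R -> L3) : Prop :=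
  exists q0 cx cm : R,
    0 < q0 /\ 0 < lam * q0 + 1 /\
    forall q v, 0 < q -> 0 < lam * q + 1 ->
      let x := cx + / 2 * RInt (fun u => 1 / sqrt (lam * u ^ 2 + u)) q0 q in
      let m := cm + / 2 * RInt (fun u => u / sqrt (lam * u ^ 2 + u)) q0 q in
      Y q v = spacelike_circle (x, m, m) (sqrt q) v.

Definition surface_of (x m : R -> R) (r v : R) : L3 :=
  spacelike_circle (x r, m r, m r) r v.

Definition rdom (lam r : R) : Prop := 0 < r /\ 0 < lam * r ^ 2 + 1.

(** Y uses the parameter q = r^2; cx and cm are the additive constants of x, m. *)
Definition parametrized_by (lam : R) (Y X : R -> R -> L3) : Prop :=
  exists cx cm : R, forall r v, rdom lam r ->
    Y (r ^ 2) v = plus ((cx, cm, cm) : L3) (X r v).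

Definition converges_to_point (X : R -> R -> L3) : Prop :=
  exists p : L3, forall v, filterlim (fun r => X r v) (at_right 0) (locally p).

(* Main.v *)
Require Import Defs.
From Stdlib Require Import Reals Lra ssreflect.
From Coquelicot Require Import Coquelicot.
Open Scope R_scope.

(** After the substitution q = r^2 the profile satisfies x' = 1/W and
    m' = r^2/W with W = sqrt (lam r^2 + 1), and nothing else about x and m is
    used beyond a differentiable inverse of x.  In terms of t = exp (- v) the
    tangent vectors and second derivatives of X are rational in r, W and t.
    Hence H = 0 is a rational identity, and
    EG - F^2 = - (r^4 / W^2) (lam + 2 W t + r^2 t^2), whose sign gives the causal
    character.  If the surface were rotational, the Killing field b x (p - p0)
    would be tangent to it; tangency is a cubic equation in t whose
    coefficients must all vanish, and as m and 2 m + r^3 / W are not constant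
    this forces b = 0. *)

(** * Profile functions and the domain of the parameter r *)

Definition W (lam r : R) : R := sqrt (lam * r ^ 2 + 1).

Definition profile (lam : R) (x m : R -> R) : Prop :=
  forall r, rdom lam r ->
    is_derive x r (/ W lam r) /\ is_derive m r (r ^ 2 / W lam r).

Lemma W_pos lam r : rdom lam r -> 0 < W lam r.
Proof. intros [_ H]; apply sqrt_lt_R0, H. Qed.

Lemma W_sqr lam r : rdom lam r -> W lam r * W lam r = lam * r ^ 2 + 1.
Proof. intros [_ H]; apply sqrt_sqrt; lra. Qed.

(** Eliminating [lam] in favour of [W] leaves r, W and t = exp (- v) as free positive variables.
    Identities that depended on the relation between [W] and [lam] then become purely rational and
    fall to [field]. *)
Lemma lam_of_W lam r : rdom lam r -> lam = (W lam r ^ 2 - 1) / r ^ 2.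
Proof.
intros H; assert (HW := W_sqr _ _ H); destruct H as [H _].
apply Rmult_eq_reg_r with (r ^ 2); [ | nra].
replace ((W lam r ^ 2 - 1) / r ^ 2 * r ^ 2) with (W lam r ^ 2 - 1); [lra | field; lra].
Qed.

Lemma open_quadratic_pos lam : open (fun r : R => 0 < lam * r ^ 2 + 1).
Proof.
apply (open_comp (fun r => lam * r ^ 2 + 1) (fun y => 0 < y)); [ | apply open_gt].
intros r _; apply: (ex_derive_continuous (fun r => lam * r ^ 2 + 1)); auto_derive; exact I.
Qed.

Lemma open_rdom lam : open (rdom lam).
Proof. apply open_and; [apply open_gt | apply open_quadratic_pos]. Qed.

Lemma rdom_nonempty lam : exists r, rdom lam r.
Proof.
destruct (open_quadratic_pos lam 0 ltac:(lra)) as [e He].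
exists (e / 2); assert (He0 := cond_pos e); split; [lra | ].
apply He; change (Rabs (e / 2 - 0) < e).
apply Rabs_def1; lra.
Qed.

Lemma rdom_near lam r : rdom lam r -> exists r', r < r' /\ forall s, r <= s <= r' -> rdom lam s.
Proof.
intros H; destruct (open_rdom lam r H) as [e He].
assert (He0 := cond_pos e).
exists (r + e / 2); split; [lra | ].
intros s Hs; apply He.
change (Rabs (s - r) < e).
apply Rabs_def1; lra.
Qed.

(** * First and second derivatives of the surface, and H = 0 *)

Lemma sinh_exp_neg v : sinh v = (/ exp (- v) - exp (- v)) / 2.
Proof. unfold sinh; rewrite exp_Ropp Rinv_inv; reflexivity. Qed.

Lemma cosh_exp_neg v : cosh v = (/ exp (- v) + exp (- v)) / 2.
Proof. unfold cosh; rewrite exp_Ropp Rinv_inv; reflexivity. Qed.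

Lemma is_derive_sinh v : is_derive sinh v (cosh v).
Proof. apply is_derive_Reals, derivable_pt_lim_sinh. Qed.

Lemma is_derive_cosh v : is_derive cosh v (sinh v).
Proof. apply is_derive_Reals, derivable_pt_lim_cosh. Qed.

Lemma is_derive_affine (a c : R) (f : R -> R) (v l : R) :
  is_derive f v l -> is_derive (fun t => a + c * f t) v (c * l).
Proof.
intros Hf; rewrite -(Rplus_0_l (c * l)).
apply: is_derive_plus; [apply: is_derive_const | apply: is_derive_scal Hf].
Qed.

Lemma surface_ofE x m r v :
  surface_of x m r v = (x r, m r + r * sinh v, m r + r * cosh v).
Proof.
change ((x r + r * 0, m r + r * sinh v, m r + r * cosh v) = (x r, m r + r * sinh v, m r + r * cosh v)).
rewrite Rmult_0_r Rplus_0_r; reflexivity.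
Qed.

Lemma Du_surface lam x m r v : profile lam x m -> rdom lam r ->
  Du (surface_of x m) r v =
  (/ W lam r, r ^ 2 / W lam r + sinh v, r ^ 2 / W lam r + cosh v).
Proof.
intros H Hr; destruct (H r Hr) as [Hx Hm].
unfold Du; repeat f_equal; apply is_derive_unique.
- apply is_derive_ext with x; [ | exact Hx].
  intros t; rewrite surface_ofE; reflexivity.
- apply is_derive_ext with (fun t => m t + t * sinh v).
  { intros t; rewrite surface_ofE; reflexivity. }
  auto_derive; [eexists; exact Hm | rewrite (is_derive_unique _ _ _ Hm); ring].
- apply is_derive_ext with (fun t => m t + t * cosh v).
  { intros t; rewrite surface_ofE; reflexivity. }
  auto_derive; [eexists; exact Hm | rewrite (is_derive_unique _ _ _ Hm); ring].
Qed.

Lemma Dv_surface x m r v :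
  Dv (surface_of x m) r v = (0, r * cosh v, r * sinh v).
Proof.
unfold Dv; repeat f_equal; apply is_derive_unique.
- apply is_derive_ext with (fun _ => x r).
  { intros t; rewrite surface_ofE; reflexivity. }
  apply: is_derive_const.
- apply is_derive_ext with (fun t => m r + r * sinh t).
  { intros t; rewrite surface_ofE; reflexivity. }
  apply is_derive_affine, is_derive_sinh.
- apply is_derive_ext with (fun t => m r + r * cosh t).
  { intros t; rewrite surface_ofE; reflexivity. }
  apply is_derive_affine, is_derive_cosh.
Qed.

Lemma is_derive_inv_W lam r : rdom lam r ->
  is_derive (fun s => / W lam s) r (- lam * r / W lam r ^ 3).
Proof.
intros H; assert (H0 := W_pos _ _ H); unfold W in *.
auto_derive.
all: replace (lam * (r * (r * 1)) + 1) with (lam * r ^ 2 + 1) by ring.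
- destruct H; repeat split; lra.
- field; lra.
Qed.

Lemma is_derive_sqr_div_W lam r : rdom lam r ->
  is_derive (fun s => s ^ 2 / W lam s) r (2 * r / W lam r - lam * r ^ 3 / W lam r ^ 3).
Proof.
intros H; assert (H0 := W_pos _ _ H); unfold W in *.
auto_derive.
all: replace (lam * (r * (r * 1)) + 1) with (lam * r ^ 2 + 1) by ring.
- destruct H; repeat split; lra.
- field; lra.
Qed.

Lemma Du_Du_surface lam x m r v : profile lam x m -> rdom lam r ->
  Du (Du (surface_of x m)) r v =
  (- lam * r / W lam r ^ 3,
   2 * r / W lam r - lam * r ^ 3 / W lam r ^ 3,
   2 * r / W lam r - lam * r ^ 3 / W lam r ^ 3).
Proof.
intros H Hr.
assert (H1 := is_derive_inv_W _ _ Hr); assert (H2 := is_derive_sqr_div_W _ _ Hr).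
unfold Du at 1; repeat f_equal; apply is_derive_unique.
(* The formula for the first derivative holds only on the domain, so the second one is computed
   through an equality near r. *)
- apply is_derive_ext_loc with (fun s => / W lam s); [ | exact H1].
  apply: filter_imp (open_rdom lam r Hr); intros s Hs.
  rewrite (Du_surface lam); auto.
- apply is_derive_ext_loc with (fun s => s ^ 2 / W lam s + sinh v).
  + apply: filter_imp (open_rdom lam r Hr); intros s Hs.
    rewrite (Du_surface lam); auto.
  + rewrite -[X in is_derive _ _ X]Rplus_0_r; apply: is_derive_plus; [exact H2 | apply: is_derive_const].
- apply is_derive_ext_loc with (fun s => s ^ 2 / W lam s + cosh v).
  + apply: filter_imp (open_rdom lam r Hr); intros s Hs.
    rewrite (Du_surface lam); auto.
  + rewrite -[X in is_derive _ _ X]Rplus_0_r; apply: is_derive_plus; [exact H2 | apply: is_derive_const].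
Qed.

Lemma Dv_Du_surface lam x m r v : profile lam x m -> rdom lam r ->
  Dv (Du (surface_of x m)) r v = (0, cosh v, sinh v).
Proof.
intros H Hr.
unfold Dv; repeat f_equal; apply is_derive_unique.
- apply is_derive_ext with (fun _ => / W lam r); [ | apply: is_derive_const].
  intros s; rewrite (Du_surface lam); auto.
- apply is_derive_ext with (fun s => r ^ 2 / W lam r + sinh s).
  + intros s; rewrite (Du_surface lam); auto.
  + rewrite -(Rplus_0_l (cosh v)); apply: is_derive_plus; [apply: is_derive_const | apply is_derive_sinh].
- apply is_derive_ext with (fun s => r ^ 2 / W lam r + cosh s).
  + intros s; rewrite (Du_surface lam); auto.
  + rewrite -(Rplus_0_l (sinh v)); apply: is_derive_plus; [apply: is_derive_const | apply is_derive_cosh].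
Qed.

Lemma Dv_Dv_surface x m r v :
  Dv (Dv (surface_of x m)) r v = (0, r * sinh v, r * cosh v).
Proof.
unfold Dv at 1; repeat f_equal; apply is_derive_unique.
- apply is_derive_ext with (fun _ => 0); [ | apply: is_derive_const].
  intros s; rewrite Dv_surface; auto.
- apply is_derive_ext with (fun s => r * cosh s).
  + intros s; rewrite Dv_surface; auto.
  + apply is_derive_scal, is_derive_cosh.
- apply is_derive_ext with (fun s => r * sinh s).
  + intros s; rewrite Dv_surface; auto.
  + apply is_derive_scal, is_derive_sinh.
Qed.

Lemma zmc_surface lam x m : profile lam x m ->
  zmc (fun r _ => rdom lam r) (surface_of x m).
Proof.
intros H r v Hr _.
unfold mean_curvature, unit_normal; cbv zeta.
rewrite (Du_surface lam x m r v) // (Dv_surface x m r v) (Du_Du_surface lam x m r v) //.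
rewrite (Dv_Du_surface lam x m r v) // (Dv_Dv_surface x m r v).
(* The unit normal is k n, and e, f, g are linear in it. The numerator e G - 2 f F + g E therefore
   carries k as a factor and vanishes whatever k is, so the square root can be made opaque. *)
set (n := lcross _ _); set (k := / sqrt _); simpl.
match goal with |- _ * ?A / _ = 0 => assert (HA : A = 0) end.
2: rewrite HA; unfold Rdiv; ring.
subst n; clearbody k.
simpl; rewrite !sinh_exp_neg !cosh_exp_neg.
assert (HW := W_pos _ _ Hr); assert (Hl := lam_of_W _ _ Hr); assert (Ht := exp_pos (- v)).
destruct Hr as [Hr _].
set (w := W lam r) in *; set (t := exp (- v)) in *; clearbody w t.
rewrite Hl; clear - HW Ht Hr.
unfold lprod, lcross, scal; simpl; unfold prod_scal, scal; simpl; unfold prod_scal, scal; simpl; unfold mult; simpl.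
unfold x1, x2, x3; simpl.
field; lra.
Qed.

(** * Regularity *)

(** A one-variable counterpart of [ex_diff_n], with the derivative given by a witness so that
    explicit formulas can be supplied order by order. *)
Fixpoint smooth_on (D : R -> Prop) (n : nat) (f : R -> R) : Prop :=
  (forall s, D s -> continuous f s) /\
  match n with
  | O => True
  | S k => exists f' : R -> R, (forall s, D s -> is_derive f s (f' s)) /\ smooth_on D k f'
  end.

Lemma smooth_on_pred D n f : smooth_on D (S n) f -> smooth_on D n f.
Proof.
revert f; induction n as [ | n IH]; intros f [Hc [f' [Hd Hf']]]; split; auto.
exists f'; split; auto.
Qed.

Lemma smooth_on_const D n c : smooth_on D n (fun _ => c).
Proof.
revert c; induction n as [ | n IH]; intros c; split; auto.
1, 2: intros s _; apply continuous_const.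
exists (fun _ => 0); split; [intros s _; apply: is_derive_const | apply IH].
Qed.

Lemma smooth_on_S (D : R -> Prop) n f f' :
  (forall s, D s -> is_derive f s (f' s)) -> smooth_on D n f' -> smooth_on D (S n) f.
Proof.
intros Hd Hf'; split.
- intros s Hs; apply: ex_derive_continuous; eexists; apply Hd, Hs.
- exists f'; auto.
Qed.

Lemma smooth_on_0 (D : R -> Prop) f :
  (forall s, D s -> ex_derive f s) -> smooth_on D 0 f.
Proof.
intros Hd; split; auto.
intros s Hs; apply: ex_derive_continuous; apply Hd, Hs.
Qed.

(** Every coordinate of the surface has the shape a s + b s * c t. This class is closed under both
    partial derivatives, which are a' s + b' s * c t and 0 + b s * c' t, so induction on n
    applies. *)
Lemma ex_diff_n_affine (D : R -> Prop) n a b c : open D ->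
  smooth_on D n a -> smooth_on D n b -> smooth_on (fun _ => True) n c ->
  forall u v, D u -> ex_diff_n (fun s t => a s + b s * c t) n u v.
Proof.
intros oD; revert a b c; induction n as [ | n IH]; intros a b c Ha Hb Hc u v Hu.
all: assert (C : continuity_2d_pt (fun s t => a s + b s * c t) u v).
1, 3: apply continuity_2d_pt_plus; [ | apply continuity_2d_pt_mult].
1, 4: apply (continuity_1d_2d_pt_comp a (fun s _ => s));
  [apply continuity_pt_filterlim; apply: (proj1 Ha) Hu | apply continuity_2d_pt_id1].
1, 3: apply (continuity_1d_2d_pt_comp b (fun s _ => s));
  [apply continuity_pt_filterlim; apply: (proj1 Hb) Hu | apply continuity_2d_pt_id1].
1, 2: apply (continuity_1d_2d_pt_comp c (fun _ t => t));
  [apply continuity_pt_filterlim; apply: (proj1 Hc) I | apply continuity_2d_pt_id2].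
- split; auto.
- assert (Hb' := smooth_on_pred _ _ _ Hb); assert (Hc' := smooth_on_pred _ _ _ Hc).
  destruct Ha as [_ [a' [da Ha]]], Hb as [_ [b' [db Hb]]], Hc as [_ [c' [dc Hc]]].
  assert (Hs : forall s t, D s -> is_derive (fun z => a z + b z * c t) s (a' s + b' s * c t)).
  { intros s t Ds; apply: is_derive_plus; [exact (da s Ds) | ].
    apply (is_derive_ext (fun z => c t * b z)); [intros; apply Rmult_comm | ].
    rewrite Rmult_comm; apply is_derive_scal, db, Ds. }
  assert (Ht : forall s t, is_derive (fun z => a s + b s * c z) t (b s * c' t)).
  { intros s t; apply is_derive_affine, dc, I. }
  split; [exact C | ].
  split; [eexists; apply Hs, Hu | ].
  split; [eexists; apply Ht | ].
  split.
  + apply ex_diff_n_ext_loc with (fun s t => a' s + b' s * c t); [ | apply IH; auto].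
    apply locally_2d_locally.
    destruct (oD u Hu) as [e He]; exists e; intros [s t] [Bs _]; simpl.
    symmetry; apply is_derive_unique, Hs, He, Bs.
    all: auto.
  + apply ex_diff_n_ext_loc with (fun s t => 0 + b s * c' t).
    * apply locally_2d_forall; intros s t.
      symmetry; rewrite Rplus_0_l; apply is_derive_unique, Ht.
    * apply IH; auto; apply smooth_on_const.
Qed.

Lemma regular_surface_profile lam x m : profile lam x m ->
  regular_surface (fun r _ => rdom lam r) (surface_of x m).
Proof.
intros H; split.
{ intros [r v] Hr; destruct (open_rdom lam r Hr) as [e He].
  exists e; intros [s t] [Bs _]; apply He, Bs. }
intros r v Hr.
assert (sx : smooth_on (rdom lam) 2 x).
{ apply smooth_on_S with (fun s => / W lam s); [apply H | ].
  apply smooth_on_S with (fun s => - lam * s / W lam s ^ 3); [apply is_derive_inv_W | ].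
  apply smooth_on_0; intros s Hs; assert (HW := W_pos _ _ Hs); unfold W in *.
  auto_derive; replace (lam * (s * (s * 1)) + 1) with (lam * s ^ 2 + 1) by ring.
  assert (0 < sqrt (lam * s ^ 2 + 1) * (sqrt (lam * s ^ 2 + 1) * (sqrt (lam * s ^ 2 + 1) * 1))).
  { repeat apply Rmult_lt_0_compat; lra. }
  destruct Hs; repeat split; lra. }
assert (sm : smooth_on (rdom lam) 2 m).
{ apply smooth_on_S with (fun s => s ^ 2 / W lam s); [apply H | ].
  apply smooth_on_S with (fun s => 2 * s / W lam s - lam * s ^ 3 / W lam s ^ 3); [apply is_derive_sqr_div_W | ].
  apply smooth_on_0; intros s Hs; assert (HW := W_pos _ _ Hs); unfold W in *.
  auto_derive; replace (lam * (s * (s * 1)) + 1) with (lam * s ^ 2 + 1) by ring.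
  assert (0 < sqrt (lam * s ^ 2 + 1) * (sqrt (lam * s ^ 2 + 1) * (sqrt (lam * s ^ 2 + 1) * 1))).
  { repeat apply Rmult_lt_0_compat; lra. }
  destruct Hs; repeat split; lra. }
assert (si : smooth_on (rdom lam) 2 (fun s => s)).
{ apply smooth_on_S with (fun _ => 1); [ | apply smooth_on_const].
  intros s _; apply: is_derive_id. }
assert (ss : smooth_on (fun _ => True) 2 sinh).
{ do 2 (eapply smooth_on_S; [intros s _; first [apply is_derive_sinh | apply is_derive_cosh] | ]).
  apply smooth_on_0; intros s _; eexists; apply is_derive_sinh. }
assert (sc : smooth_on (fun _ => True) 2 cosh).
{ do 2 (eapply smooth_on_S; [intros s _; first [apply is_derive_sinh | apply is_derive_cosh] | ]).
  apply smooth_on_0; intros s _; eexists; apply is_derive_cosh. }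
split; [ | split; [ | split]].
- apply ex_diff_n_ext_loc with (fun s t => x s + 0 * 0).
  { apply locally_2d_forall; intros s t; rewrite surface_ofE; unfold x1; simpl; ring. }
  apply (ex_diff_n_affine (rdom lam) 2 x (fun _ => 0) (fun _ => 0)); auto using open_rdom, smooth_on_const.
- apply ex_diff_n_ext_loc with (fun s t => m s + s * sinh t).
  { apply locally_2d_forall; intros s t; rewrite surface_ofE; reflexivity. }
  apply (ex_diff_n_affine (rdom lam) 2 m (fun s => s) sinh); auto using open_rdom.
- apply ex_diff_n_ext_loc with (fun s t => m s + s * cosh t).
  { apply locally_2d_forall; intros s t; rewrite surface_ofE; reflexivity. }
  apply (ex_diff_n_affine (rdom lam) 2 m (fun s => s) cosh); auto using open_rdom.
- intros a b; rewrite (Du_surface lam) // Dv_surface; intros E.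
  (* [Dv] has no x1 component and that of [Du] is 1 / W, whence a = 0. The x2 component is then b r
     cosh v, whence b = 0. *)
  assert (E1 := f_equal x1 E); assert (E3 := f_equal x2 E).
  change (a * / W lam r + b * 0 = 0) in E1.
  change (a * (r ^ 2 / W lam r + sinh v) + b * (r * cosh v) = 0) in E3.
  assert (HW := Rinv_0_lt_compat _ (W_pos _ _ Hr)).
  assert (a = 0) by nra; subst a; split; [reflexivity | ].
  destruct Hr as [Hr _].
  assert (0 < cosh v) by (unfold cosh; generalize (exp_pos v) (exp_pos (- v)); lra).
  assert (0 < r * cosh v) by (apply Rmult_lt_0_compat; assumption).
  nra.
Qed.

(** * The surface is not rotational *)

Lemma is_derive_coords (f : R -> L3) t l : is_derive f t l ->
  is_derive (fun s => x1 (f s)) t (x1 l) /\ is_derive (fun s => x2 (f s)) t (x2 l) /\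
  is_derive (fun s => x3 (f s)) t (x3 l).
Proof.
intros Hf.
assert (Hl : forall (g : L3 -> R), is_linear g -> is_derive (fun s => g (f s)) t (g l)).
{ intros g Hg.
  apply filterdiff_ext_lin with (fun y => g (scal y l)); [ | intros y; apply linear_scal, Hg].
  apply (filterdiff_comp' f g); [exact Hf | apply filterdiff_linear, Hg]. }
split; [ | split]; apply Hl.
- apply: (is_linear_comp (fun p : L3 => fst p) (fun p => fst p)); apply is_linear_fst.
- apply: (is_linear_comp (fun p : L3 => fst p) (fun p => snd p)); [apply is_linear_fst | apply is_linear_snd].
- apply is_linear_snd.
Qed.

(** On the surface the radius is a differentiable function [rho] of x1, with derivative W = 1 / x'.
    This yields an implicit equation for the surface and shows that distinct circles lie in distinct
    planes. *)
Definition inverse_profile (lam : R) (x rho : R -> R) : Prop :=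
  forall r, rdom lam r -> rho (x r) = r /\ is_derive rho (x r) (W lam r).

Lemma is_derive_minus_sqr_plus (f g h k : R -> R) t f' g' h' k' :
  is_derive f t f' -> is_derive g t g' -> is_derive h t h' -> is_derive k t k' ->
  is_derive (fun s => (f s - h s) ^ 2 - (g s - h s) ^ 2 + k s ^ 2) t
    (2 * (f t - h t) * (f' - h') - 2 * (g t - h t) * (g' - h') + 2 * k t * k').
Proof.
intros Df Dg Dh Dk; auto_derive.
- repeat split; eexists; eassumption.
- rewrite (is_derive_unique _ _ _ Df) (is_derive_unique _ _ _ Dg)
    (is_derive_unique _ _ _ Dh) (is_derive_unique _ _ _ Dk); ring.
Qed.

(* The surface satisfies (x2 - m)^2 - (x3 - m)^2 + r^2 = 0 where r = rho x1;
   this equation is differentiated along gam at time 0. *)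
Lemma velocity_tangent lam x m rho (gam : R -> L3) (w : L3) r v :
  profile lam x m -> inverse_profile lam x rho -> rdom lam r ->
  gam 0 = surface_of x m r v -> is_derive gam 0 w ->
  locally 0 (fun t => exists r' v', rdom lam r' /\ gam t = surface_of x m r' v') ->
  sinh v * x2 w - cosh v * x3 w + (r ^ 2 * exp (- v) + W lam r) * x1 w = 0.
Proof.
intros H Hrho Hr H0 Hw Hin.
destruct (is_derive_coords _ _ _ Hw) as [D1 [D2 D3]].
destruct (Hrho r Hr) as [Er Dr], (H r Hr) as [_ Dm].
rewrite surface_ofE in H0.
assert (P := W_pos _ _ Hr).
assert (DR : is_derive (fun t => rho (x1 (gam t))) 0 (x1 w * W lam r)).
{ apply (is_derive_comp rho); [ | exact D1]; rewrite H0; exact Dr. }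
assert (DM : is_derive (fun t => m (rho (x1 (gam t)))) 0 (x1 w * W lam r * (r ^ 2 / W lam r))).
{ apply (is_derive_comp m (fun t => rho (x1 (gam t)))); [ | exact DR]; rewrite H0; unfold x1; simpl; rewrite Er; exact Dm. }
set (h := fun t => (x2 (gam t) - m (rho (x1 (gam t)))) ^ 2
  - (x3 (gam t) - m (rho (x1 (gam t)))) ^ 2 + rho (x1 (gam t)) ^ 2).
(* [h] vanishes near 0 because [gam] stays in the surface. Equating this zero derivative with the
   one from the chain rule gives 2 r times the desired relation. *)
assert (Dh0 : is_derive h 0 0).
{ apply is_derive_ext_loc with (fun _ => 0); [ | apply: is_derive_const].
  apply: filter_imp Hin; intros t [r' [v' [Hr' E]]].
  unfold h; rewrite E surface_ofE; unfold x1, x2, x3; simpl.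
  rewrite (proj1 (Hrho r' Hr')) sinh_exp_neg cosh_exp_neg.
  field; apply Rgt_not_eq, exp_pos. }
assert (Dh : is_derive h 0
  (2 * (r * sinh v) * (x2 w - x1 w * r ^ 2) - 2 * (r * cosh v) * (x3 w - x1 w * r ^ 2)
   + 2 * r * (x1 w * W lam r))).
{ assert (Dq := is_derive_minus_sqr_plus _ _ _ _ _ _ _ _ _ D2 D3 DM DR); cbv beta in Dq.
  assert (E1 : x1 (gam 0) = x r) by (rewrite H0; reflexivity).
  assert (E2 : x2 (gam 0) = m r + r * sinh v) by (rewrite H0; reflexivity).
  assert (E3 : x3 (gam 0) = m r + r * cosh v) by (rewrite H0; reflexivity).
  rewrite E1 E2 E3 Er in Dq.
  match type of Dq with is_derive _ _ ?l => match goal with |- is_derive _ _ ?l' =>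
    replace l' with l by (field; lra) end end.
  exact Dq. }
assert (E := is_derive_unique _ _ _ Dh); rewrite (is_derive_unique _ _ _ Dh0) in E.
destruct Hr as [Hr _].
apply Rmult_eq_reg_l with (2 * r); [ | lra].
replace (exp (- v)) with (cosh v - sinh v) by (rewrite sinh_exp_neg cosh_exp_neg; lra).
rewrite Rmult_0_r {1}E; ring.
Qed.

Lemma is_derive_locally_const (D : R -> Prop) f c s l : open D -> D s ->
  (forall t, D t -> f t = c) -> is_derive f s l -> l = 0.
Proof.
intros oD Ds Hc Hd; rewrite -(is_derive_unique _ _ _ Hd).
rewrite (Derive_ext_loc f (fun _ => c)); [apply Derive_const | ].
apply: filter_imp (oD s Ds); exact Hc.
Qed.

(** A cubic with the four roots 1, 2, 3, 4 is zero: the evaluations form an invertible linear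
    (Vandermonde) system. *)
Lemma cubic_eq0 c0 c1 c2 c3 :
  (forall t, 0 < t -> c0 + c1 * t + c2 * t ^ 2 + c3 * t ^ 3 = 0) ->
  c0 = 0 /\ c1 = 0 /\ c2 = 0 /\ c3 = 0.
Proof.
intros H.
assert (H1 := H 1 ltac:(lra)); assert (H2 := H 2 ltac:(lra));
  assert (H3 := H 3 ltac:(lra)); assert (H4 := H 4 ltac:(lra)).
repeat split; lra.
Qed.

Lemma not_rotational lam x m rho :
  profile lam x m -> inverse_profile lam x rho ->
  ~ rotational (fun r _ => rdom lam r) (surface_of x m).
Proof.
intros H Hrho [[[p1 p2] p3] [[[b1 b2] b3] [Hb Hrot]]].
assert (K : forall r, rdom lam r ->
  b2 + b3 = 0 /\ W lam r * (b2 * (m r - p3) - b3 * (m r - p2)) + r ^ 3 * (b2 - b3) / 2 = 0 /\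
  (x r - p1) * (- b3 - b2) / 2 + b1 * (2 * m r - p2 - p3) / 2
    + r ^ 2 * (b2 * (m r - p3) - b3 * (m r - p2)) + W lam r * r * (b2 + b3) / 2 = 0).
{ intros r Hr; assert (r0 := proj1 Hr).
  destruct (cubic_eq0
    ((b3 - b2) * (x r - p1 - W lam r * r) / 2 - b1 * (p2 - p3) / 2)
    (W lam r * (b2 * (m r - p3) - b3 * (m r - p2)) + r ^ 3 * (b2 - b3) / 2)
    ((x r - p1) * (- b3 - b2) / 2 + b1 * (2 * m r - p2 - p3) / 2
      + r ^ 2 * (b2 * (m r - p3) - b3 * (m r - p2)) + W lam r * r * (b2 + b3) / 2)
    (r ^ 3 * (b2 + b3) / 2)) as [_ [C0 [C1 C2]]].
  - intros t Ht.
    (* At v = - ln t one has exp (- v) = t, and the tangency relation for the Killing field is the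
       cubic divided by t. *)
    destruct (Hrot r (- ln t) Hr) as [gam [eps [He [G0 G]]]].
    assert (T : sinh (- ln t) * x2 (lcross (b1, b2, b3) (minus (gam 0) (p1, p2, p3)))
      - cosh (- ln t) * x3 (lcross (b1, b2, b3) (minus (gam 0) (p1, p2, p3)))
      + (r ^ 2 * exp (- - ln t) + W lam r) * x1 (lcross (b1, b2, b3) (minus (gam 0) (p1, p2, p3))) = 0).
    { apply (velocity_tangent lam x m rho gam _ r (- ln t) H Hrho Hr G0).
      - apply (G 0); rewrite Rabs_R0; exact He.
      - exists (mkposreal eps He); intros t' B.
        apply G; rewrite -(Rminus_0_r t'); exact B. }
    rewrite G0 surface_ofE sinh_exp_neg cosh_exp_neg Ropp_involutive exp_ln // in T.
    unfold lcross, x1, x2, x3 in T; simpl in T.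
    apply Rmult_eq_reg_l with (/ t); [ | apply Rgt_not_eq, Rinv_0_lt_compat, Ht].
    rewrite Rmult_0_r -T.
    unfold plus, opp; simpl.
    field; lra.
  - split; [ | auto].
    assert (0 < r ^ 3) by (apply pow_lt, r0).
    apply Rmult_eq_reg_l with (r ^ 3); lra. }
destruct (rdom_nonempty lam) as [r Hr]; assert (r0 := proj1 Hr).
assert (HW := W_pos _ _ Hr); assert (WW := W_sqr _ _ Hr).
assert (r2 : 0 < r ^ 2) by (apply pow_lt, r0).
assert (E3 : b3 = - b2) by (destruct (K r Hr); lra); subst b3.
destruct (H r Hr) as [_ Dm].
(* With b3 = - b2 the coefficient of t is b2 (W (2 m - p2 - p3) + r^3). If b2 were nonzero, 2 m +
   r^3 / W would be the constant p2 + p3. *)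
assert (E2 : b2 = 0).
{ destruct (Req_dec b2 0) as [ | N]; [assumption | exfalso].
  assert (Z : 2 * (r ^ 2 / W lam r) + (3 * r ^ 2 / W lam r - lam * r ^ 4 / W lam r ^ 3) = 0).
  { apply (is_derive_locally_const (rdom lam) (fun s => 2 * m s + s * (s ^ 2 / W lam s)) (p2 + p3) r);
      auto using open_rdom.
    - intros s Hs; destruct (K s Hs) as [_ [E _]].
      assert (Ws := W_pos _ _ Hs).
      apply Rmult_eq_reg_l with (b2 * W lam s); [ | nra].
      replace (b2 * W lam s * (2 * m s + s * (s ^ 2 / W lam s)))
        with (b2 * W lam s * 2 * m s + b2 * s ^ 3) by (field; lra).
      lra.
    - apply: is_derive_plus; [apply is_derive_scal, Dm | ].
      assert (D2 := is_derive_sqr_div_W _ _ Hr).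
      replace (3 * r ^ 2 / W lam r - lam * r ^ 4 / W lam r ^ 3)
        with (1 * (r ^ 2 / W lam r) + r * (2 * r / W lam r - lam * r ^ 3 / W lam r ^ 3)) by (field; lra).
      apply: is_derive_mult; [apply: is_derive_id | exact D2 | apply Rmult_comm]. }
  assert (Z' : r ^ 2 / W lam r ^ 3 * (5 * W lam r ^ 2 - lam * r ^ 2) = 0).
  { rewrite -[RHS]Z; field; lra. }
  assert (0 < r ^ 2 / W lam r ^ 3) by (apply Rdiv_lt_0_compat; [ | apply pow_lt]; assumption).
  (* The left factor of the derivative equals 4 W^2 + 1 because lam r^2 = W^2 - 1. *)
  assert (0 < 5 * W lam r ^ 2 - lam * r ^ 2) by (destruct Hr; nra).
  nra. }
subst b2.
apply Hb.
(* Once b2 = b3 = 0, the coefficient of t^2 is b1 (2 m - p2 - p3) / 2, so a nonzero b1 would make m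
   constant, against m' = r^2 / W > 0. *)
assert (b1 = 0).
{ destruct (Req_dec b1 0) as [ | N]; [assumption | exfalso].
  assert (Z : r ^ 2 / W lam r = 0).
  { apply (is_derive_locally_const (rdom lam) m ((p2 + p3) / 2) r); auto using open_rdom.
    intros s Hs; destruct (K s Hs) as [_ [_ E]].
    apply Rmult_eq_reg_l with b1; lra. }
  assert (0 < r ^ 2 / W lam r) by (apply Rdiv_lt_0_compat; assumption).
  lra. }
subst b1; rewrite Ropp_0; reflexivity.
Qed.

(** * The foliation by circles, and the Riemann example for any profile *)

Lemma foliated_surface lam x m rho : inverse_profile lam x rho ->
  foliated_by_spacelike_circles (fun r _ => rdom lam r) (surface_of x m).
Proof.
intros Hrho.
exists (fun r => (x r, m r, m r)), (fun r => r); split; [ | split].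
- intros r v Hr; split; [apply Hr | exists v; reflexivity].
- intros r v r' v' Hr Hr' Hne E; apply Hne.
  change (x r = x r') in E.
  rewrite -(proj1 (Hrho r Hr)) -(proj1 (Hrho r' Hr')) E; reflexivity.
- destruct (rdom_nonempty lam) as [r Hr].
  destruct (rdom_near lam r Hr) as [r' [Lr Hr']].
  exists r, 0, r', 0; split; [exact Hr | split; [apply Hr'; lra | lra]].
Qed.

Lemma riemann_zmc_example_profile lam x m rho :
  profile lam x m -> inverse_profile lam x rho ->
  riemann_zmc_example (fun r _ => rdom lam r) (surface_of x m).
Proof.
intros H Hrho; split; [ | split; [ | split]].
- apply regular_surface_profile, H.
- apply zmc_surface, H.
- apply not_rotational with rho; assumption.
- apply foliated_surface with rho, Hrho.
Qed.

(** * Causal character *)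

(* EG - F^2 = - (r^4 / W^2) discr. *)
Definition discr (lam r v : R) : R :=
  lam + 2 * W lam r * exp (- v) + r ^ 2 * exp (- v) ^ 2.

Definition tvec (X : R -> R -> L3) (r v a b : R) : L3 :=
  plus (scal a (Du X r v)) (scal b (Dv X r v)).

(** The three coefficients are E, F and G of the first fundamental form. Since the direction (1, 1)
    of the centres is null, v enters only through cosh v - sinh v = exp (- v); and G = r^2 is always
    positive. *)
Lemma lprod_tvec lam x m r v a b a' b' : profile lam x m -> rdom lam r ->
  lprod (tvec (surface_of x m) r v a b) (tvec (surface_of x m) r v a' b') =
  a * a' * (r ^ 2 / W lam r ^ 2 * (- lam - 2 * W lam r * exp (- v)))
  + (a * b' + a' * b) * (r ^ 3 * exp (- v) / W lam r) + b * b' * r ^ 2.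
Proof.
intros H Hr; unfold tvec; rewrite (Du_surface lam x m r v) // (Dv_surface x m r v).
change (lprod
  (a * / W lam r + b * 0, a * (r ^ 2 / W lam r + sinh v) + b * (r * cosh v),
   a * (r ^ 2 / W lam r + cosh v) + b * (r * sinh v))
  (a' * / W lam r + b' * 0, a' * (r ^ 2 / W lam r + sinh v) + b' * (r * cosh v),
   a' * (r ^ 2 / W lam r + cosh v) + b' * (r * sinh v)) =
  a * a' * (r ^ 2 / W lam r ^ 2 * (- lam - 2 * W lam r * exp (- v)))
  + (a * b' + a' * b) * (r ^ 3 * exp (- v) / W lam r) + b * b' * r ^ 2).
unfold lprod, x1, x2, x3; cbv [fst snd].
rewrite sinh_exp_neg cosh_exp_neg.
assert (HW := W_pos _ _ Hr); assert (Hl := lam_of_W _ _ Hr); assert (Ht := exp_pos (- v)).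
destruct Hr as [Hr _].
set (w := W lam r) in *; set (t := exp (- v)) in *; clearbody w t.
rewrite Hl; field; lra.
Qed.

Lemma timelike_of_discr lam x m r v : profile lam x m -> rdom lam r ->
  0 < discr lam r v -> timelike_at (surface_of x m) r v.
Proof.
intros H Hr HD; assert (HW := W_pos _ _ Hr); assert (r0 := proj1 Hr).
(* The witnesses are [Dv], of square G > 0, and G [Du] - F [Dv], which is orthogonal to it and has
   square G (EG - F^2). *)
exists (tvec (surface_of x m) r v 0 1),
  (tvec (surface_of x m) r v (r ^ 2) (- (r ^ 3 * exp (- v) / W lam r))).
split; [do 2 eexists; reflexivity | split; [do 2 eexists; reflexivity | ]].
rewrite !(lprod_tvec lam) //; split; [ | split].
- assert (0 < r ^ 2) by (apply pow_lt, r0); lra.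
- assert (0 < r ^ 6 / W lam r ^ 2 * discr lam r v).
  { apply Rmult_lt_0_compat; [apply Rdiv_lt_0_compat; apply pow_lt | ]; assumption. }
  match goal with |- ?A < 0 => replace A with (- (r ^ 6 / W lam r ^ 2 * discr lam r v)) end; [lra | ].
  unfold discr; field; lra.
- field; lra.
Qed.

Lemma tvec_neq0 lam x m r v a b : profile lam x m -> rdom lam r -> a <> 0 ->
  tvec (surface_of x m) r v a b <> zero.
Proof.
intros H Hr Ha E.
destruct (proj2 (regular_surface_profile lam x m H) r v Hr) as [_ [_ [_ Hreg]]].
exact (Ha (proj1 (Hreg a b E))).
Qed.

Lemma lightlike_of_discr lam x m r v : profile lam x m -> rdom lam r ->
  discr lam r v = 0 -> lightlike_at (surface_of x m) r v.
Proof.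
intros H Hr HD; assert (HW := W_pos _ _ Hr); assert (r0 := proj1 Hr).
(* The vector G [Du] - F [Dv] again: its product with a' [Du] + b' [Dv] is a' (EG - F^2), so it
   spans the radical of the degenerate metric. *)
exists (tvec (surface_of x m) r v (r ^ 2) (- (r ^ 3 * exp (- v) / W lam r))).
split; [do 2 eexists; reflexivity | split].
- apply tvec_neq0 with lam; [exact H | exact Hr | apply pow_nonzero; lra].
- intros w' [a' [b' ->]]; fold (tvec (surface_of x m) r v a' b').
  rewrite (lprod_tvec lam) //.
  match goal with |- ?A = 0 => replace A with (- (a' * r ^ 4 / W lam r ^ 2 * discr lam r v)) end;
    [rewrite HD; ring | unfold discr; field; lra].
Qed.

Lemma spacelike_of_discr lam x m r v : profile lam x m -> rdom lam r ->
  discr lam r v < 0 -> spacelike_at (surface_of x m) r v.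
Proof.
intros H Hr HD w [a [b ->]]; fold (tvec (surface_of x m) r v a b); intros Hw.
assert (HW := W_pos _ _ Hr); assert (r0 := proj1 Hr).
rewrite (lprod_tvec lam) //.
(* Completing the square in b: the form is (r b + a F / r)^2 + a^2 (E - F^2 / G). *)
match goal with |- 0 < ?A => replace A with
  ((r * b + a * (r ^ 2 * exp (- v) / W lam r)) ^ 2 + a ^ 2 * (r ^ 2 / W lam r ^ 2 * - discr lam r v)) end;
  [ | unfold discr; field; lra].
assert (P : 0 < r ^ 2 / W lam r ^ 2 * - discr lam r v).
{ apply Rmult_lt_0_compat; [apply Rdiv_lt_0_compat; apply pow_lt; assumption | lra]. }
destruct (Req_dec a 0) as [-> | Ha].
- assert (Hb : b <> 0).
  { intros ->; apply Hw; unfold tvec; rewrite !(@scal_zero_l R_Ring) plus_zero_l; reflexivity. }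
  assert (0 < (r * b) ^ 2) by (apply pow2_gt_0, Rmult_integral_contrapositive; split; lra).
  rewrite Rmult_0_l Rplus_0_r; lra.
- assert (0 < a ^ 2) by (apply pow2_gt_0, Ha).
  assert (Q := pow2_ge_0 (r * b + a * (r ^ 2 * exp (- v) / W lam r))).
  assert (0 < a ^ 2 * (r ^ 2 / W lam r ^ 2 * - discr lam r v)) by (apply Rmult_lt_0_compat; assumption).
  lra.
Qed.

(* As a quadratic in t = exp (- v), discr has the positive root (1 - W) / r^2. *)
Lemma all_causal_types lam x m r : profile lam x m -> rdom lam r -> lam < 0 ->
  (exists v, spacelike_at (surface_of x m) r v) /\
  (exists v, lightlike_at (surface_of x m) r v) /\
  (exists v, timelike_at (surface_of x m) r v).
Proof.
intros H Hr Hl; assert (HW := W_pos _ _ Hr); assert (r0 := proj1 Hr).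
assert (r2 : 0 < r ^ 2) by (apply pow_lt, r0).
assert (W1 : W lam r < 1).
{ assert (WW := W_sqr _ _ Hr); nra. }
set (t := (1 - W lam r) / r ^ 2).
assert (t0 : 0 < t) by (apply Rdiv_lt_0_compat; lra).
assert (Et : lam + 2 * W lam r * t + r ^ 2 * t ^ 2 = 0).
{ rewrite [X in X + _ + _](lam_of_W lam r Hr) /t; field; lra. }
(* With exp (- v) equal to t / 2 and 2 t, [discr] takes the values - (W t + 3/4 r^2 t^2) and 2 W t +
   3 r^2 t^2. *)
assert (P : 0 < r ^ 2 * t ^ 2) by (apply Rmult_lt_0_compat, pow_lt; assumption).
assert (Q : 0 < W lam r * t) by (apply Rmult_lt_0_compat; assumption).
split; [ | split].
- exists (- ln (t / 2)); apply spacelike_of_discr with lam; [exact H | exact Hr | ].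
  unfold discr; rewrite Ropp_involutive exp_ln; lra.
- exists (- ln t); apply lightlike_of_discr with lam; [exact H | exact Hr | ].
  unfold discr; rewrite Ropp_involutive exp_ln; lra.
- exists (- ln (2 * t)); apply timelike_of_discr with lam; [exact H | exact Hr | ].
  unfold discr; rewrite Ropp_involutive exp_ln; lra.
Qed.

(** * From the integrals in q to a profile in r *)

Lemma parametrized_by_profile lam x m Y : profile lam x m ->
  corresponds_to_11 lam Y -> parametrized_by lam Y (surface_of x m).
Proof.
intros H [q0 [cx [cm [Hq0 [Hq0' HY]]]]].
exists (cx - x (sqrt q0)), (cm - m (sqrt q0)); intros r v Hr.
assert (r0 := proj1 Hr).
assert (Hq : 0 < r ^ 2) by (apply pow_lt, r0).
rewrite (HY (r ^ 2) v Hq (proj2 Hr)).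
(* Both conditions are affine in u, so they pass from the endpoints to the whole interval of
   integration. *)
assert (Hdom : forall u, Rmin q0 (r ^ 2) <= u <= Rmax q0 (r ^ 2) -> 0 < u /\ 0 < lam * u + 1).
{ destruct Hr as [_ Hr]; intros u.
  unfold Rmin, Rmax; destruct (Rle_dec q0 (r ^ 2)); intros Hu; split; try lra; nra. }
(* The substitution u = s^2 in general form: 2 y (sqrt u) is a primitive of f. The value at sqrt q0
   goes into the additive constant. *)
assert (Hint : forall (y y' f : R -> R),
  (forall s, rdom lam s -> is_derive y s (y' s)) ->
  (forall u, 0 < u -> 0 < lam * u + 1 -> f u = 2 * (/ (2 * sqrt u) * y' (sqrt u)) /\ continuous f u) ->
  / 2 * RInt f q0 (r ^ 2) = y r - y (sqrt q0)).
{ intros y y' f Dy Df.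
  assert (I : is_RInt f q0 (r ^ 2) (minus (2 * y (sqrt (r ^ 2))) (2 * y (sqrt q0)))).
  { apply (is_RInt_derive (fun u => 2 * y (sqrt u)) f).
    - intros u Hu; destruct (Hdom u Hu) as [u0 u1]; rewrite (proj1 (Df u u0 u1)).
      apply is_derive_scal.
      apply: is_derive_comp.
      + apply Dy; split; [apply sqrt_lt_R0, u0 | rewrite (pow2_sqrt u (Rlt_le _ _ u0)); exact u1].
      + replace (/ (2 * sqrt u)) with (1 / (2 * sqrt u)) by (unfold Rdiv; ring).
        apply: is_derive_sqrt u0; apply: is_derive_id.
    - intros u Hu; destruct (Hdom u Hu) as [u0 u1]; apply Df; assumption. }
  rewrite (is_RInt_unique _ _ _ _ I) (sqrt_pow2 r (Rlt_le _ _ r0)).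
  unfold minus, plus, opp; simpl; lra. }
assert (Hs : forall u, 0 < u -> 0 < lam * u + 1 ->
  sqrt (lam * u ^ 2 + u) = sqrt u * W lam (sqrt u) /\ 0 < sqrt u /\ 0 < W lam (sqrt u) /\ 0 < lam * u ^ 2 + u).
{ intros u u0 u1; unfold W; rewrite (pow2_sqrt u (Rlt_le _ _ u0)).
  rewrite -sqrt_mult; try lra.
  repeat split; try (apply sqrt_lt_R0; assumption).
  - f_equal; ring.
  - nra. }
assert (Ix : / 2 * RInt (fun u => 1 / sqrt (lam * u ^ 2 + u)) q0 (r ^ 2) = x r - x (sqrt q0)).
{ apply (Hint x (fun s => / W lam s)); [intros s Ds; apply H, Ds | ].
  intros u u0 u1; destruct (Hs u u0 u1) as [-> [s0 [w0 p]]]; split.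
  - field; lra.
  - apply: ex_derive_continuous; auto_derive.
    replace (lam * (u * (u * 1)) + u) with (lam * u ^ 2 + u) by ring.
    assert (0 < sqrt (lam * u ^ 2 + u)) by (apply sqrt_lt_R0, p); repeat split; lra. }
assert (Im : / 2 * RInt (fun u => u / sqrt (lam * u ^ 2 + u)) q0 (r ^ 2) = m r - m (sqrt q0)).
{ apply (Hint m (fun s => s ^ 2 / W lam s)); [intros s Ds; apply H, Ds | ].
  intros u u0 u1; destruct (Hs u u0 u1) as [-> [s0 [w0 p]]]; split.
  - rewrite -{1}(sqrt_sqrt u (Rlt_le _ _ u0)); field; lra.
  - apply: ex_derive_continuous; auto_derive.
    replace (lam * (u * (u * 1)) + u) with (lam * u ^ 2 + u) by ring.
    assert (0 < sqrt (lam * u ^ 2 + u)) by (apply sqrt_lt_R0, p); repeat split; lra. }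
cbv zeta; rewrite Ix Im (sqrt_pow2 r (Rlt_le _ _ r0)).
change (surface_of (fun _ => cx + (x r - x (sqrt q0))) (fun _ => cm + (m r - m (sqrt q0))) r v =
  plus ((cx - x (sqrt q0), cm - m (sqrt q0), cm - m (sqrt q0)) : L3) (surface_of x m r v)).
rewrite !surface_ofE.
change ((cx + (x r - x (sqrt q0)), cm + (m r - m (sqrt q0)) + r * sinh v, cm + (m r - m (sqrt q0)) + r * cosh v)
 = (cx - x (sqrt q0) + x r, cm - m (sqrt q0) + (m r + r * sinh v), cm - m (sqrt q0) + (m r + r * cosh v))).
f_equal; [f_equal | ]; ring.
Qed.

(** * Convergence to a point as r tends to 0 *)

Lemma locally_prod {U V : UniformSpace} (a : U) (b : V) :
  filter_le (filter_prod (locally a) (locally b)) (locally (a, b)).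
Proof.
intros P [e He]; exists (ball a e) (ball b e); try apply locally_ball.
intros u w Hu Hw; apply He; split; assumption.
Qed.

(** For fixed v the term r (0, sinh v, cosh v) tends to zero, so only the centre contributes and the
    limit does not depend on v. *)
Lemma converges_profile x m lx lm :
  filterlim x (at_right 0) (locally lx) -> filterlim m (at_right 0) (locally lm) ->
  converges_to_point (surface_of x m).
Proof.
intros Hx Hm; exists (lx, lm, lm); intros v.
assert (Hid : forall c : R, filterlim (fun r : R => r * c) (at_right 0) (locally 0)).
{ intros c; rewrite -{2}(Rmult_0_l c).
  apply: filterlim_filter_le_1; [apply: filter_le_within | ].
  apply: (ex_derive_continuous (fun r : R => r * c)); auto_derive; exact I. }
assert (Hc : forall c : R, filterlim (fun r => m r + r * c) (at_right 0) (locally lm)).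
{ intros c; rewrite -(Rplus_0_r lm).
  apply: filterlim_comp_2; [exact Hm | apply Hid | apply: (filterlim_plus lm 0)]. }
apply filterlim_ext with (fun r => (x r, m r + r * sinh v, m r + r * cosh v)).
{ intros r; rewrite surface_ofE; reflexivity. }
apply: filterlim_filter_le_2; [apply locally_prod | ].
apply: filterlim_pair; [ | apply Hc].
apply: filterlim_filter_le_2; [apply locally_prod | ].
apply: filterlim_pair; [exact Hx | apply Hc].
Qed.

(** * Elementary functions in the closed forms *)

Lemma Rpower_3_2 a : 0 < a -> Rpower a (3 / 2) = a * sqrt a.
Proof.
intros Ha; replace (3 / 2) with (1 + / 2) by field.
rewrite Rpower_plus Rpower_1 // Rpower_sqrt //.
Qed.

Lemma is_derive_arcsinh y : is_derive arcsinh y (/ sqrt (y ^ 2 + 1)).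
Proof. apply is_derive_Reals, derivable_pt_lim_arcsinh. Qed.

Lemma is_derive_asin y : -1 < y < 1 -> is_derive asin y (/ sqrt (1 - y ^ 2)).
Proof.
intros Hy; apply is_derive_Reals.
apply (derive_pt_eq_1 _ _ _ (derivable_pt_asin y Hy)); rewrite derive_pt_asin /Rsqr.
replace (1 - y ^ 2) with (1 - y * y) by ring; unfold Rdiv; ring.
Qed.

Lemma cosh_arcsinh y : cosh (arcsinh y) = sqrt (y ^ 2 + 1).
Proof.
symmetry; rewrite -{1}(sinh_arcsinh y); apply sqrt_lem_1.
- assert (H := pow2_ge_0 (sinh (arcsinh y))); lra.
- unfold cosh; generalize (exp_pos (arcsinh y)) (exp_pos (- arcsinh y)); lra.
- rewrite sinh_exp_neg cosh_exp_neg; field; apply Rgt_not_eq, exp_pos.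
Qed.

(** For y = sin a, the double angle formula gives 2 y^2 - 1 = - cos (2 a) = sin (2 a - PI / 2). As a
    lies between 0 and PI / 2, the angle 2 a - PI / 2 is in the range of [asin]. *)
Lemma asin_double_sqr_sub1 y : 0 <= y <= 1 -> asin (2 * y ^ 2 - 1) = 2 * asin y - PI / 2.
Proof.
intros Hy; assert (HB := asin_bound y); assert (S := sin_asin y ltac:(lra)).
assert (H0 : 0 <= asin y).
{ destruct (Rle_lt_dec 0 (asin y)) as [ | N]; [assumption | exfalso].
  assert (0 < sin (- asin y)) by (apply sin_gt_0; generalize PI_RGT_0; lra).
  rewrite sin_neg S in H; lra. }
replace (2 * y ^ 2 - 1) with (sin (2 * asin y - PI / 2)); [apply asin_sin; lra | ].
rewrite -(Ropp_involutive (sin _)) -sin_neg.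
replace (- (2 * asin y - PI / 2)) with (PI / 2 - 2 * asin y) by ring.
rewrite sin_shift cos_2a_sin S; ring.
Qed.

Lemma filterlim_at_right_derive (f : R -> R) (x l : R) : is_derive f x l ->
  filterlim f (at_right x) (locally (f x)).
Proof.
intros Hd; apply: filterlim_filter_le_1; [apply: filter_le_within | ].
apply: (ex_derive_continuous f); exists l; exact Hd.
Qed.

Lemma is_derive_mult_W lam r : rdom lam r \/ r = 0 ->
  is_derive (fun s => s * W lam s) r ((2 * lam * r ^ 2 + 1) / W lam r).
Proof.
intros H.
assert (P : 0 < lam * r ^ 2 + 1) by (destruct H as [[_ H] | ->]; lra).
assert (Q := sqrt_lt_R0 _ P); assert (S := sqrt_sqrt (lam * r ^ 2 + 1) (Rlt_le _ _ P)); unfold W.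
auto_derive; replace (lam * (r * (r * 1)) + 1) with (lam * r ^ 2 + 1) by ring.
- lra.
- set (w := sqrt _) in *; clearbody w.
  apply Rmult_eq_reg_r with w; [ | lra].
  replace ((2 * lam * r ^ 2 + 1) / w * w) with (2 * lam * r ^ 2 + 1) by (field; lra).
  match goal with |- ?A = _ => replace A with (w * w + lam * r ^ 2) by (field; lra) end.
  rewrite S; ring.
Qed.

(** * Explicit profiles for lam = 0, lam = k^2 and lam = - k^2 *)

Lemma W_0 r : W 0 r = 1.
Proof. unfold W; rewrite Rmult_0_l Rplus_0_l; apply sqrt_1. Qed.

Lemma profile_zero : profile 0 (fun r => r) (fun r => r ^ 3 / 3).
Proof.
intros r _; rewrite W_0; split.
- rewrite Rinv_1; apply: is_derive_id.
- auto_derive; [exact I | field].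
Qed.

Lemma inverse_profile_zero : inverse_profile 0 (fun r => r) (fun r => r).
Proof.
intros r _; rewrite W_0; split; [reflexivity | apply: is_derive_id].
Qed.

Lemma is_derive_comp_scal (f : R -> R) k r l : is_derive f (k * r) l ->
  is_derive (fun s => f (k * s)) r (k * l).
Proof.
intros Hf; apply: (is_derive_comp f (fun s => k * s)); [exact Hf | ].
auto_derive; [exact I | ring].
Qed.

Lemma is_derive_arcsinh_scaled k r : 0 < k ->
  is_derive (fun s => arcsinh (k * s)) r (k / W (k ^ 2) r).
Proof.
intros Hk; unfold W, Rdiv.
replace (k ^ 2 * r ^ 2 + 1) with ((k * r) ^ 2 + 1) by ring.
apply is_derive_comp_scal, is_derive_arcsinh.
Qed.

Lemma is_derive_profile_pos k r : 0 < k -> rdom (k ^ 2) r \/ r = 0 ->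
  is_derive (fun s => 1 / k * arcsinh (k * s)) r (/ W (k ^ 2) r) /\
  is_derive (fun s => 1 / (2 * k ^ 3) * (k * s * W (k ^ 2) s - arcsinh (k * s))) r
    (r ^ 2 / W (k ^ 2) r).
Proof.
intros Hk Hr.
assert (Da := is_derive_arcsinh_scaled k r Hk).
assert (Dw := is_derive_mult_W (k ^ 2) r Hr).
assert (Wp : 0 < W (k ^ 2) r).
{ destruct Hr as [Hr | ->]; [apply W_pos, Hr | unfold W; apply sqrt_lt_R0; lra]. }
split.
- replace (/ W (k ^ 2) r) with (1 / k * (k / W (k ^ 2) r)) by (field; lra).
  apply is_derive_scal, Da.
- replace (r ^ 2 / W (k ^ 2) r) with (1 / (2 * k ^ 3) *
    (k * ((2 * k ^ 2 * r ^ 2 + 1) / W (k ^ 2) r) - k / W (k ^ 2) r)) by (field; lra).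
  apply is_derive_scal; apply: is_derive_minus; [ | exact Da].
  apply (is_derive_ext (fun s => k * (s * W (k ^ 2) s))); [intros s; symmetry; apply Rmult_assoc | ].
  apply is_derive_scal, Dw.
Qed.

Lemma inverse_profile_pos k : 0 < k ->
  inverse_profile (k ^ 2) (fun r => 1 / k * arcsinh (k * r)) (fun y => / k * sinh (k * y)).
Proof.
intros Hk r Hr; assert (E : k * (1 / k * arcsinh (k * r)) = arcsinh (k * r)) by (field; lra).
split.
- rewrite E sinh_arcsinh; field; lra.
- replace (W (k ^ 2) r) with (/ k * (k * cosh (k * (1 / k * arcsinh (k * r))))).
  + apply is_derive_scal, is_derive_comp_scal, is_derive_sinh.
  + rewrite E cosh_arcsinh; unfold W.
    replace (k ^ 2 * r ^ 2 + 1) with ((k * r) ^ 2 + 1) by ring.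
    field; lra.
Qed.

Lemma rdom_neg k r : 0 < k -> rdom (- k ^ 2) r -> 0 < k * r < 1.
Proof.
intros Hk [r0 H]; assert (0 < k * r) by (apply Rmult_lt_0_compat; assumption).
split; [assumption | nra].
Qed.

Lemma is_derive_asin_scaled k r : -1 < k * r < 1 ->
  is_derive (fun s => asin (k * s)) r (k / W (- k ^ 2) r).
Proof.
intros Hr; unfold W, Rdiv.
replace (- k ^ 2 * r ^ 2 + 1) with (1 - (k * r) ^ 2) by ring.
apply is_derive_comp_scal, is_derive_asin, Hr.
Qed.

(** In m, 2 asin (k s) - PI / 2 stands for asin (2 (k s)^2 - 1). The two agree for 0 <= k s <= 1,
    and the former is visibly differentiable at s = 0, where the argument of the latter reaches -1,
    an endpoint of the domain of [asin]. *)
Lemma is_derive_profile_neg k r : 0 < k -> rdom (- k ^ 2) r \/ r = 0 ->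
  is_derive (fun s => 1 / k * asin (k * s)) r (/ W (- k ^ 2) r) /\
  is_derive (fun s => 1 / (2 * - k ^ 2) * s * W (- k ^ 2) s
    + 1 / (4 * k ^ 3) * (2 * asin (k * s) - PI / 2)) r (r ^ 2 / W (- k ^ 2) r).
Proof.
intros Hk Hr.
assert (B : -1 < k * r < 1).
{ destruct Hr as [Hr | ->]; [assert (B := rdom_neg k r Hk Hr) | ]; lra. }
assert (Da := is_derive_asin_scaled k r B).
assert (Dw := is_derive_mult_W (- k ^ 2) r Hr).
assert (Wp : 0 < W (- k ^ 2) r).
{ destruct Hr as [Hr | ->]; [apply W_pos, Hr | unfold W; apply sqrt_lt_R0; lra]. }
split.
- replace (/ W (- k ^ 2) r) with (1 / k * (k / W (- k ^ 2) r)) by (field; lra).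
  apply is_derive_scal, Da.
- replace (r ^ 2 / W (- k ^ 2) r) with (1 / (2 * - k ^ 2) * ((2 * - k ^ 2 * r ^ 2 + 1) / W (- k ^ 2) r)
    + 1 / (4 * k ^ 3) * (2 * (k / W (- k ^ 2) r) - 0)) by (field; lra).
  apply: is_derive_plus.
  + apply (is_derive_ext (fun s => 1 / (2 * - k ^ 2) * (s * W (- k ^ 2) s))); [intros s; symmetry; apply Rmult_assoc | ].
    apply is_derive_scal, Dw.
  + apply is_derive_scal; apply: is_derive_minus; [ | apply: is_derive_const].
    apply is_derive_scal, Da.
Qed.

Lemma inverse_profile_neg k : 0 < k ->
  inverse_profile (- k ^ 2) (fun r => 1 / k * asin (k * r)) (fun y => / k * sin (k * y)).
Proof.
intros Hk r Hr; assert (B := rdom_neg k r Hk Hr).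
assert (E : k * (1 / k * asin (k * r)) = asin (k * r)) by (field; lra).
split.
- rewrite E sin_asin; last lra; field; lra.
- replace (W (- k ^ 2) r) with (/ k * (k * cos (k * (1 / k * asin (k * r))))).
  + apply is_derive_scal, is_derive_comp_scal, is_derive_Reals, derivable_pt_lim_sin.
  + rewrite E cos_asin; last lra; unfold W, Rsqr.
    replace (- k ^ 2 * r ^ 2 + 1) with (1 - k * r * (k * r)) by ring.
    field; lra.
Qed.

Theorem proposition4p6 (lam : R) (Y : R -> R -> L3)
    (hY : corresponds_to_11 lam Y) :
  (lam = 0 ->
     let X := surface_of (fun r => r) (fun r => r ^ 3 / 3) in
     riemann_zmc_example (fun r _ => rdom lam r) X /\
     parametrized_by lam Y X /\
     (forall r v, rdom lam r -> timelike_at X r v) /\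
     converges_to_point X) /\
  (0 < lam ->
     let X := surface_of
       (fun r => 1 / sqrt lam * arcsinh (sqrt lam * r))
       (fun r => 1 / (2 * Rpower lam (3 / 2)) *
          (sqrt lam * r * sqrt (lam * r ^ 2 + 1) - arcsinh (sqrt lam * r))) in
     riemann_zmc_example (fun r _ => rdom lam r) X /\
     parametrized_by lam Y X /\
     converges_to_point X) /\
  (lam < 0 ->
     let X := surface_of
       (fun r => 1 / sqrt (- lam) * asin (sqrt (- lam) * r))
       (fun r => 1 / (2 * lam) * r * sqrt (lam * r ^ 2 + 1) +
          1 / (4 * Rpower (- lam) (3 / 2)) * asin (- 2 * lam * r ^ 2 - 1)) in
     riemann_zmc_example (fun r _ => rdom lam r) X /\
     parametrized_by lam Y X /\
     (forall r, rdom lam r ->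
        (exists v, spacelike_at X r v) /\
        (exists v, lightlike_at X r v) /\
        (exists v, timelike_at X r v)) /\
     (forall r v, rdom lam r ->
        0 < x1 (X r v) < PI / (2 * sqrt (- lam))) /\
     converges_to_point X).
Proof.
split; [ | split]; intros Hlam.
- subst lam; intros X.
  split; [apply (riemann_zmc_example_profile _ _ _ _ profile_zero inverse_profile_zero) | ].
  split; [apply (parametrized_by_profile _ _ _ _ profile_zero hY) | ].
  split.
  + intros r v Hr; apply (timelike_of_discr _ _ _ _ _ profile_zero Hr).
    (* Here [discr] is 2 t + r^2 t^2 with t = exp (- v) > 0. *)
    unfold discr; rewrite W_0; assert (Ht := exp_pos (- v)).
    assert (0 <= r ^ 2 * exp (- v) ^ 2) by (apply Rmult_le_pos; apply pow2_ge_0).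
    lra.
  + apply (converges_profile _ _ 0 (0 ^ 3 / 3)).
    * apply (filterlim_at_right_derive (fun r => r) 0 1); apply: is_derive_id.
    * apply (filterlim_at_right_derive (fun r => r ^ 3 / 3) 0 0).
      auto_derive; [exact I | field].
- assert (Hk := sqrt_lt_R0 _ Hlam); rewrite (Rpower_3_2 _ Hlam).
  (* Taking k = sqrt lam as the parameter turns lam into k^2 and its power 3/2 into k^3. *)
  assert (El : lam = sqrt lam ^ 2) by (rewrite pow2_sqrt; lra).
  set (k := sqrt lam) in *; clearbody k; subst lam; clear Hlam.
  replace (k ^ 2 * k) with (k ^ 3) by ring; intros X.
  assert (HP : profile (k ^ 2) (fun r => 1 / k * arcsinh (k * r))
    (fun r => 1 / (2 * k ^ 3) * (k * r * sqrt (k ^ 2 * r ^ 2 + 1) - arcsinh (k * r)))).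
  { intros r Hr; apply is_derive_profile_pos; auto. }
  split; [apply (riemann_zmc_example_profile _ _ _ _ HP (inverse_profile_pos k Hk)) | ].
  split; [apply (parametrized_by_profile _ _ _ _ HP hY) | ].
  destruct (is_derive_profile_pos k 0 Hk (or_intror eq_refl)) as [Dx Dm].
  apply: converges_profile; [exact (filterlim_at_right_derive _ _ _ Dx) | exact (filterlim_at_right_derive _ _ _ Dm)].
- assert (Hlam' : 0 < - lam) by lra.
  assert (Hk := sqrt_lt_R0 _ Hlam'); rewrite (Rpower_3_2 _ Hlam').
  assert (El : lam = - sqrt (- lam) ^ 2) by (rewrite pow2_sqrt; lra).
  set (k := sqrt (- lam)) in *; clearbody k; subst lam; clear Hlam'.
  replace (- - k ^ 2 * k) with (k ^ 3) by ring; intros X.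
  assert (Em : forall r, 0 < r -> k * r < 1 ->
    1 / (2 * - k ^ 2) * r * W (- k ^ 2) r + 1 / (4 * k ^ 3) * (2 * asin (k * r) - PI / 2) =
    1 / (2 * - k ^ 2) * r * sqrt (- k ^ 2 * r ^ 2 + 1)
      + 1 / (4 * k ^ 3) * asin (- 2 * - k ^ 2 * r ^ 2 - 1)).
  { intros r r0 r1; rewrite -asin_double_sqr_sub1; last nra.
    unfold W; do 3 f_equal; ring. }
  assert (HP : profile (- k ^ 2) (fun r => 1 / k * asin (k * r))
    (fun r => 1 / (2 * - k ^ 2) * r * sqrt (- k ^ 2 * r ^ 2 + 1)
      + 1 / (4 * k ^ 3) * asin (- 2 * - k ^ 2 * r ^ 2 - 1))).
  { intros r Hr; destruct (is_derive_profile_neg k r Hk (or_introl Hr)) as [Dx Dm]; split; [exact Dx | ].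
    eapply is_derive_ext_loc; [ | exact Dm].
    apply: filter_imp (open_rdom (- k ^ 2) r Hr); intros s Hs.
    apply Em; [apply Hs | apply (rdom_neg k s Hk Hs)]. }
  split; [apply (riemann_zmc_example_profile _ _ _ _ HP (inverse_profile_neg k Hk)) | ].
  split; [apply (parametrized_by_profile _ _ _ _ HP hY) | ].
  split; [intros r Hr; apply (all_causal_types (- k ^ 2)); assumption | ].
  split.
  (* The coordinate x1 is asin (k r) / k with 0 < k r < 1, so the angle lies strictly between 0 and
     PI / 2. *)
  + intros r v Hr; unfold X; rewrite surface_ofE; unfold x1; cbn [fst].
    assert (B := rdom_neg k r Hk Hr).
    assert (B1 := asin_bound_lt (k * r) ltac:(lra)).
    assert (0 < asin (k * r)).
    { destruct (Rlt_le_dec 0 (asin (k * r))) as [ | N]; [assumption | exfalso].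
      assert (S := sin_asin (k * r) ltac:(lra)).
      assert (0 <= sin (- asin (k * r))) by (apply sin_ge_0; generalize PI_RGT_0; lra).
      rewrite sin_neg S in H; lra. }
    assert (K := Rinv_0_lt_compat _ Hk).
    replace (PI / (2 * k)) with (/ k * (PI / 2)) by (field; lra).
    unfold Rdiv at 1 2; rewrite Rmult_1_l.
    split; [apply Rmult_lt_0_compat | apply Rmult_lt_compat_l]; lra.
  + destruct (is_derive_profile_neg k 0 Hk (or_intror eq_refl)) as [Dx Dm].
    apply: converges_profile; [exact (filterlim_at_right_derive _ _ _ Dx) | ].
    (* The stated m agrees with its differentiable form for 0 < r < 1 / k, which is enough for a
       limit from the right at 0. *)
    apply: filterlim_ext_loc (filterlim_at_right_derive _ _ _ Dm).
    assert (K := Rinv_0_lt_compat _ Hk).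
    assert (Hb : forall r : R, Rabs r < / k -> k * r < 1).
    { intros r Br; apply Rabs_def2 in Br.
      apply Rmult_lt_reg_l with (/ k); [exact K | ].
      replace (/ k * (k * r)) with r by (field; lra); lra. }
    exists (mkposreal _ K); intros r Br r0; apply Em; [exact r0 | apply Hb].
    rewrite -(Rminus_0_r r); exact Br.
Qed.
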